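(* Let $\kappa,\tau\ge 0$ be given numbers where, if $\kappa=0$, then $\tau=0$. Put $\chi^2=\kappa^2+\tau^2+1$ and $$\omega_1=\sqrt{\frac{\chi^2-\sqrt{\chi^4-4\tau^2}}{2}},\qquad \omega_2=\sqrt{\frac{\chi^2+\sqrt{\chi^4-4\tau^2}}{2}} .$$ (1) If $\boldsymbol{\alpha}$ and $\boldsymbol{\beta}$ are two helices in $\mathbb{S}^3$ with the same curvature $\kappa$ and torsion $\tau$, then $\boldsymbol{\alpha}$ and $\boldsymbol{\beta}$ are congruent, i.e., there is a Riemannian isometry $f:\mathbb{S}^3\to\mathbb{S}^3$ such that $\boldsymbol{\beta}=f\circ\boldsymbol{\alpha}$. (2) A helix $\boldsymbol{\gamma}$ in $\mathbb{S}^3$ with curvature $\kappa$ and torsion $\tau$ is periodic if and only if the ratio of the angular frequencies $$\frac{\omega_1}{\omega_2}=\sqrt{\frac{\chi^2-\sqrt{\chi^4-4\tau^2}}{\chi^2+\sqrt{\chi^4-4\tau^2}}}$$ is a rational number. (3) If $\kappa,\tau>0$ and $\boldsymbol{\gamma}$ is a helix in $\mathbb{S}^3$ with curvature $\kappa$ and torsion $\tau$, there exists a Clifford torus $\mathbb{T}^2_{\boldsymbol{\gamma}}$ contained in $\mathbb{S}^3$ such that the image of $\boldsymbol{\gamma}$ lies on $\mathbb{T}^2_{\boldsymbol{\gamma}}$. (4) If $\kappa,\tau>0$ and $\frac{\omega_1}{\omega_2}$ is irrational, the image of such a helix $\boldsymbol{\gamma}$ is dense in the torus $\mathbb{T}^2_{\boldsymbol{\gamma}}$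 of (3).
   Context: $\mathbb{S}^3=\{x\in\mathbb{R}^4: x_1^2+x_2^2+x_3^2+x_4^2=1\}$ carries the Riemannian metric induced from Euclidean $\mathbb{R}^4$. Curvature and torsion (non-oriented convention). Let $M$ be a Riemannian 3-manifold, $I\subseteq\mathbb{R}$ an open interval, $\boldsymbol{\gamma}:I\to M$ a smooth curve parametrized by arc length $t$, $\mathbf{T}=\boldsymbol{\gamma}'$, and let $\frac{D}{dt}$ be covariant differentiation along $\boldsymbol{\gamma}$. The curvature is $\kappa(t)=\left|\frac{D}{dt}\mathbf{T}(t)\right|$. It is assumed that $\kappa$ is either nowhere zero or identically zero. If $\kappa$ is nowhere zero, put $\mathbf{N}=\frac1\kappa\frac{D}{dt}\mathbf{T}$ and define the torsion by $\tau(t)=\left|\frac{D}{dt}\mathbf{N}(t)+\kappa(t)\mathbf{T}(t)\right|\ge 0$; it is assumed that $\tau$ is either nowhere zero or identically zero. If $\kappa\equiv 0$, the torsion is by definition $\tau\equiv 0$. A helix in $M$ is a (smooth, arc-length parametrized) curve $\boldsymbol{\gamma}:I\to M$, where $I\subseteq\mathbb{R}$ is an open interval, whose curvature $\kappa$ and torsion $\tau$ are non-negative constants. A helix $\boldsymbol{\gamma}$ is periodic if there is a $T>0$ such that $\boldsymbol{\gamma}(t+T)=\boldsymbol{\gamma}(t)$ for each $t\in I$. The numbers $\omega_1,\omega_2$ are called the fundamental angular frequencies of a helix in $\mathbb{S}^3$ with curvature $\kappa$ and torsion $\tau$: such a helix has the form $\boldsymbol{\gamma}(t)=\cos(\omega_1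 t)\mathbf{A}_1+\sin(\omega_1 t)\mathbf{B}_1+\cos(\omega_2 t)\mathbf{A}_2+\sin(\omega_2 t)\mathbf{B}_2$ with constant vectors $\mathbf{A}_1,\mathbf{B}_1,\mathbf{A}_2,\mathbf{B}_2\in\mathbb{R}^4$. A Clifford torus is a Riemannian 2-manifold which is the metric product of two circles; a Clifford torus contained in $\mathbb{S}^3$ is one embedded in $\mathbb{S}^3$ with the induced metric. Example: for $0<\lambda<1$, $\{x\in\mathbb{R}^4: x_1^2+x_2^2=\lambda,\ x_3^2+x_4^2=1-\lambda\}$.
   Formalization: In (2), where I is bounded above and γ(t+T) is undefined, periodicity is read on a continuation of γ to a helix on a larger interval; in (4), false for bounded I (the image is an arc), density is asserted for γ or its continuations on unbounded intervals; intervals are nonempty. *)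

(* Defs.v *)
From HB Require Import structures.
From mathcomp Require Import all_boot all_order all_algebra.
From mathcomp Require Import all_classical all_reals all_analysis.

Set Implicit Arguments.
Unset Strict Implicit.
Unset Printing Implicit Defensive.

Import Order.TTheory GRing.Theory Num.Theory.
Import numFieldNormedType.Exports.

Local Open Scope classical_set_scope.
Local Open Scope ring_scope.

(* The library norm on row vectors is the sup norm; it only provides the
   topology and the differential calculus of R^4.  Lengths are Euclidean. *)
Definition dot (R : realType) (u v : 'rV[R]_4) : R :=
  \sum_(i < 4) u 0 i * v 0 i.

Definition enorm (R : realType) (u : 'rV[R]_4) : R := Num.sqrt (dot u u).

Definition S3 (R : realType) : set 'rV[R]_4 :=
  [set x | \sum_(i < 4) x 0 i ^+ 2 = 1].

Definition open_interval (R : realType) (I : set R) : Prop :=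
  [/\ open I, is_interval I & I !=set0].

(* Curves are total functions on R; only their values on I matter. *)
Definition smooth_curve_in (R : realType) (A : set 'rV[R]_4) (I : set R)
    (gamma : R -> 'rV[R]_4) : Prop :=
  forall t, I t -> A (gamma t) /\ forall n, derivable (derive1n n gamma) t 1.

(* The Levi-Civita connection of the metric induced on S3 is the tangential
   part of the flat one: p is the unit normal of S3 at p. *)
Definition covD (R : realType) (gamma V : R -> 'rV[R]_4) (t : R) : 'rV[R]_4 :=
  derive1 V t - dot (derive1 V t) (gamma t) *: gamma t.

Definition curvature (R : realType) (gamma : R -> 'rV[R]_4) (t : R) : R :=
  enorm (covD gamma (derive1 gamma) t).

Definition normalN (R : realType) (gamma : R -> 'rV[R]_4) (t : R) :
    'rV[R]_4 :=
  (curvature gamma t)^-1 *: covD gamma (derive1 gamma) t.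

(* Only meaningful when the curvature is nowhere zero or identically zero,
   which is automatic for curves of constant curvature. *)
Definition torsion (R : realType) (gamma : R -> 'rV[R]_4) (t : R) : R :=
  if curvature gamma t == 0 then 0
  else enorm (covD gamma (normalN gamma) t
              + curvature gamma t *: derive1 gamma t).

Definition helix (R : realType) (kappa tau : R) (I : set R)
    (gamma : R -> 'rV[R]_4) : Prop :=
  [/\ open_interval I,
      smooth_curve_in (@S3 R) I gamma,
      forall t, I t -> enorm (derive1 gamma t) = 1,
      forall t, I t -> curvature gamma t = kappa
    & forall t, I t -> torsion gamma t = tau].

Definition helix_continuation (R : realType) (kappa tau : R)
    (I : set R) (gamma : R -> 'rV[R]_4) (J : set R) (delta : R -> 'rV[R]_4) :
    Prop :=
  [/\ I `<=` J, helix kappa tau J delta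
    & forall t, I t -> delta t = gamma t].

(* gamma(t + T) need not make sense when I is bounded above; it is then read
   on a continuation of the helix.  If t + T stays in I, one may take J := I,
   and the condition is just gamma(t + T) = gamma(t) on I. *)
Definition periodic_helix (R : realType) (kappa tau : R) (I : set R)
    (gamma : R -> 'rV[R]_4) : Prop :=
  exists T : R, 0 < T /\ exists J delta,
    helix_continuation kappa tau I gamma J delta /\
    forall t, I t -> J (t + T) /\ delta (t + T) = gamma t.

(* All iterated directional derivatives are differentiable on U, which for the
   open set U of R^4 amounts to being C^oo on U. *)
Definition smooth_on (R : realType) (U : set 'rV[R]_4)
    (F : 'rV[R]_4 -> 'rV[R]_4) : Prop :=
  forall (vs : seq 'rV[R]_4) x, U x ->
    differentiable (foldr (fun v G => 'D_v G) F vs) x.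

(* Smoothness of a map on a subset of R^4: local extension to smooth maps on
   open sets of R^4. *)
Definition smooth_map (R : realType) (A : set 'rV[R]_4)
    (f : 'rV[R]_4 -> 'rV[R]_4) : Prop :=
  forall p, A p -> exists U F,
    [/\ open_nbhs p U, smooth_on U F & forall x, A x -> U x -> F x = f x].

(* Tangent vectors of A at p are the velocities c'(0) of the smooth curves c
   in A with c(0) = p, and df_p (c'(0)) = (f o c)'(0). *)
Definition preserves_metric (R : realType) (A : set 'rV[R]_4)
    (f : 'rV[R]_4 -> 'rV[R]_4) : Prop :=
  forall (I : set R) (c d : R -> 'rV[R]_4),
    open_nbhs 0 I -> smooth_curve_in A I c -> smooth_curve_in A I d ->
    c 0 = d 0 ->
    dot (derive1 (f \o c) 0) (derive1 (f \o d) 0)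
      = dot (derive1 c 0) (derive1 d 0).

(* Riemannian isometry of A onto B, for the metrics induced from R^4. *)
Definition riemannian_isometry (R : realType) (A B : set 'rV[R]_4)
    (f : 'rV[R]_4 -> 'rV[R]_4) : Prop :=
  [/\ set_bij A B f,
      smooth_map A f,
      exists g, smooth_map B g /\ forall x, A x -> g (f x) = x
    & preserves_metric A f].

(* The product of the circles of radii r1 and r2; its product metric is the
   one induced from R^2 x R^2 = R^4. *)
Definition circle_product (R : realType) (r1 r2 : R) : set 'rV[R]_4 :=
  [set x | x 0 0 ^+ 2 + x 0 1 ^+ 2 = r1 ^+ 2 /\
           x 0 2 ^+ 2 + x 0 3 ^+ 2 = r2 ^+ 2].

Definition clifford_torus_in_S3 (R : realType) (T : set 'rV[R]_4) : Prop :=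
  T `<=` @S3 R /\
  exists r1 r2 : R, [/\ 0 < r1, 0 < r2
    & exists phi, riemannian_isometry (circle_product r1 r2) T phi].

Definition dense_in (R : realType) (A T : set 'rV[R]_4) : Prop :=
  A `<=` T /\ T `<=` closure A.

(* Main.v *)
Require Import Defs.
From HB Require Import structures.
From mathcomp Require Import all_boot all_order all_algebra.
From mathcomp Require Import all_classical all_reals all_analysis.
From mathcomp Require Import ring lra zify.

Set Implicit Arguments.
Unset Strict Implicit.
Unset Printing Implicit Defensive.

Import Order.TTheory GRing.Theory Num.Theory.
Import numFieldNormedType.Exports.

Local Open Scope classical_set_scope.
Local Open Scope ring_scope.

(* For a helix, the Gram matrix of the derivatives of order at most 3 is
   constant and depends only on [kappa] and [tau], and the helix solves
   [y'''' + chi^2 y'' + tau^2 y = 0].  The curve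
     c(t) = (r1 cos(w1 t), r1 sin(w1 t), r2 cos(w2 t), r2 sin(w2 t)),
   with [r1^2 + r2^2 = 1] and [r1^2 w1^2 + r2^2 w2^2 = 1], has the same Gram
   matrix and solves the same equation.  Vectors with the same Gram matrix
   differ by an orthogonal map, so every helix is [c] followed by an orthogonal
   map.  Congruence, the torus and the period are then read off [c], and
   density is Kronecker's theorem for [w1 / w2]. *)

(** * Euclidean geometry of R^4 *)

(** Differentiating constant inner products recovers the whole Gram matrix from its diagonal;
    curvature and torsion enter only through the squared lengths of the second and third
    derivatives. The numbers w1^2 and w2^2 are the roots of X^2 - chi^2 X + tau^2. They are distinct
    because, for nonnegative [kappa] and [tau], chi^4 - 4 tau^2 vanishes only at [kappa = 0],
    [tau = 1], which the convention for [kappa = 0] excludes. The model covers the degenerate cases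
    too: w1 = 0 if [tau = 0], and r1 = 0 if [kappa = 0], when it is a great circle. A helix may live
    on a short interval, so periodicity and density concern its continuations; uniqueness for the
    differential equation identifies these with the model, which is defined on all of R. An
    unbounded continuation may fill only a half-line, so Kronecker's theorem is needed with a lower
    bound on the integer multiplier. *)

Lemma dot_mulmx (R : realType) (u v : 'rV[R]_4) : dot u v = (u *m v^T) 0 0.
Proof. by rewrite mxE; apply: eq_bigr => i _; rewrite mxE. Qed.

Lemma dotE (R : realType) (u v : 'rV[R]_4) :
  dot u v = u 0 0 * v 0 0 + u 0 1 * v 0 1 + u 0 2 * v 0 2 + u 0 3 * v 0 3.
Proof.
rewrite /dot !big_ord_recr big_ord0 /= add0r.
by congr (_ * _ + _ * _ + _ * _ + _ * _); congr (_ 0 _); apply/val_inj.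
Qed.

Lemma dotC (R : realType) (u v : 'rV[R]_4) : dot u v = dot v u.
Proof. by apply: eq_bigr => i _; rewrite mulrC. Qed.

Lemma dotDl (R : realType) (u v w : 'rV[R]_4) :
  dot (u + v) w = dot u w + dot v w.
Proof. by rewrite !dot_mulmx mulmxDl mxE. Qed.

Lemma dotZl (R : realType) a (u v : 'rV[R]_4) : dot (a *: u) v = a * dot u v.
Proof. by rewrite !dot_mulmx -scalemxAl mxE. Qed.

Lemma dotDr (R : realType) (u v w : 'rV[R]_4) :
  dot w (u + v) = dot w u + dot w v.
Proof. by rewrite dotC dotDl ![dot _ w]dotC. Qed.

Lemma dotZr (R : realType) a (u v : 'rV[R]_4) : dot u (a *: v) = a * dot u v.
Proof. by rewrite dotC dotZl dotC. Qed.

Lemma dotNl (R : realType) (u v : 'rV[R]_4) : dot (- u) v = - dot u v.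
Proof. by rewrite -scaleN1r dotZl mulN1r. Qed.

Lemma dotNr (R : realType) (u v : 'rV[R]_4) : dot u (- v) = - dot u v.
Proof. by rewrite dotC dotNl dotC. Qed.

Definition dot_lin (R : realType) :=
  (@dotDl R, @dotDr R, @dotZl R, @dotZr R, @dotNl R, @dotNr R).

Lemma dot_ge0 (R : realType) (u : 'rV[R]_4) : 0 <= dot u u.
Proof. by apply: sumr_ge0 => i _; rewrite -expr2 sqr_ge0. Qed.

Lemma dot_eq0 (R : realType) (u : 'rV[R]_4) : dot u u = 0 -> u = 0.
Proof.
move/eqP; rewrite psumr_eq0; last by move=> i _; rewrite -expr2 sqr_ge0.
move/allP=> u0; apply/rowP => i; rewrite mxE.
by have := u0 i (mem_index_enum _); rewrite mulf_eq0 orbb => /eqP.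
Qed.

Lemma enorm_sqr (R : realType) (u : 'rV[R]_4) : enorm u ^+ 2 = dot u u.
Proof. by rewrite sqr_sqrtr ?dot_ge0. Qed.

Lemma enorm_eq (R : realType) (u : 'rV[R]_4) a :
  0 <= a -> dot u u = a ^+ 2 -> enorm u = a.
Proof. by move=> a0 ua; rewrite /enorm ua sqrtr_sqr ger0_norm. Qed.

Lemma S3E (R : realType) (u : 'rV[R]_4) : S3 u <-> dot u u = 1.
Proof. by rewrite /S3 /dot /=; under eq_bigr do rewrite expr2. Qed.

Definition isometry_mx (R : realType) (Q : 'M[R]_4) := Q *m Q^T = 1%:M.

Lemma isometry_mx_tr (R : realType) (Q : 'M[R]_4) :
  isometry_mx Q -> isometry_mx Q^T.
Proof. by move=> /mulmx1C QQ; rewrite /isometry_mx trmxK. Qed.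

Lemma isometry_mxM (R : realType) (P Q : 'M[R]_4) :
  isometry_mx P -> isometry_mx Q -> isometry_mx (P *m Q).
Proof.
by rewrite /isometry_mx => PP QQ; rewrite trmx_mul mulmxA -(mulmxA P) QQ mulmx1.
Qed.

Lemma isometry_mx_dot (R : realType) (Q : 'M[R]_4) u v :
  isometry_mx Q -> dot (u *m Q) (v *m Q) = dot u v.
Proof.
by move=> QQ; rewrite !dot_mulmx trmx_mul mulmxA -(mulmxA u) QQ mulmx1.
Qed.

Lemma isometry_mxK (R : realType) (Q : 'M[R]_4) (u : 'rV_4) :
  isometry_mx Q -> u *m Q *m Q^T = u.
Proof. by move=> QQ; rewrite -mulmxA QQ mulmx1. Qed.

Definition reflmx (R : realType) (w : 'rV[R]_4) : 'M[R]_4 :=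
  1%:M - (2 / dot w w) *: (w^T *m w).

Lemma mul_reflmx (R : realType) (u w : 'rV[R]_4) :
  u *m reflmx w = u - (2 * dot u w / dot w w) *: w.
Proof.
rewrite mulmxBr mulmx1 -scalemxAr mulmxA [u *m w^T]mx11_scalar -dot_mulmx.
by rewrite mul_scalar_mx scalerA; congr (_ - _ *: _); ring.
Qed.

(** The matrix is symmetric and an involution, hence its transpose is its inverse. *)
Lemma reflmx_ortho (R : realType) (w : 'rV[R]_4) : isometry_mx (reflmx w).
Proof.
(* For [w = 0] the rank-one term vanishes and the reflection is the identity, so [gram_ortho] can
   use it without knowing that [w] is nonzero. *)
have [->|w0] := eqVneq w 0.
  by rewrite /isometry_mx /reflmx mulmx0 scaler0 subr0 trmx1 mulmx1.
have ww0 : dot w w != 0 by apply: contra_neq w0; exact: dot_eq0.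
have trF : (reflmx w)^T = reflmx w.
  by rewrite /reflmx linearB linearZ /= trmx1 trmx_mul trmxK.
have FF (u : 'rV_4) : u *m reflmx w *m reflmx w = u.
  rewrite mul_reflmx (_ : dot _ w = - dot u w); last first.
    by rewrite mul_reflmx !dot_lin; field.
  by rewrite mulrN mulNr scaleNr opprK mul_reflmx subrK.
by apply/row_matrixP => i; rewrite trF row_mul !rowE FF mulmx1.
Qed.

(* Householder: the reflection in [u_k Q - v_k] corrects [Q] at [u_k] and, by
   equality of the Gram matrices, fixes the previous vectors. *)
Lemma gram_ortho (R : realType) k (u v : nat -> 'rV[R]_4) :
  (forall i j, (i < k)%N -> (j < k)%N -> dot (u i) (u j) = dot (v i) (v j)) ->
  exists2 Q, isometry_mx Q & forall i, (i < k)%N -> u i *m Q = v i.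
Proof.
elim: k => [|k IH] uv.
  by exists 1%:M => //; rewrite /isometry_mx trmx1 mulmx1.
have [i j ik jk|Q QQ uQ] := IH; first by apply: uv; exact: ltnW.
set w := u k *m Q - v k.
exists (Q *m reflmx w) => [|i].
  exact: isometry_mxM QQ (reflmx_ortho w).
rewrite ltnS leq_eqVlt mulmxA mul_reflmx => /predU1P[->|ik]; last first.
  rewrite (_ : dot _ w = 0) ?mulr0 ?mul0r ?scale0r ?subr0 ?uQ //.
  by rewrite /w dotDr dotNr -{1}(uQ i) // isometry_mx_dot // uv ?subrr //
    ltnS ltnW.
have [w0|w0] := eqVneq w 0.
  by rewrite w0 scaler0 subr0; apply/eqP; rewrite -subr_eq0 -/w w0.
have ww0 : dot w w != 0 by apply: contra_neq w0; exact: dot_eq0.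
(* Since [u k *m Q] and [v k] have equal lengths, the reflection moves the former by exactly [w]. *)
suff -> : 2 * dot (u k *m Q) w = dot w w.
  by rewrite divff // scale1r opprB addrC subrK.
rewrite {}/w in ww0 w0 *; rewrite !dot_lin !(dotC (v k)) isometry_mx_dot //.
by rewrite (uv k k) //; ring.
Qed.

(** * Curves and their derivatives *)

Lemma is_derive_coord (R : realType) (f : R -> 'rV[R]_4) (t : R) df i :
  is_derive t 1 f df -> is_derive t 1 (fun s => f s 0 i) (df 0 i).
Proof.
move=> [fd <-]; apply: DeriveDef; first by have /derivable_mxP := fd; apply.
by rewrite derive_mx // mxE.
Qed.

Lemma is_derive_row (R : realType) (f : R -> 'rV[R]_4) (t : R) (df : 'rV[R]_4) :
  (forall i, is_derive t 1 (fun s => f s 0 i) (df 0 i)) ->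
  is_derive t 1 f df.
Proof.
move=> fdf; have fd : derivable f t 1.
  by apply/derivable_mxP => i j; rewrite ord1; case: (fdf j).
apply: DeriveDef => //; apply/rowP => i.
by rewrite derive_mx // mxE; case: (fdf i).
Qed.

Lemma is_derive_dot (R : realType) (f g : R -> 'rV[R]_4) (t : R) df dg :
  is_derive t 1 f df -> is_derive t 1 g dg ->
  is_derive t 1 (fun s => dot (f s) (g s)) (dot df (g t) + dot (f t) dg).
Proof.
move=> fdf gdg.
rewrite (_ : (fun s => _) =
  \sum_(i < 4) (fun s => f s 0 i * g s 0 i)); last first.
  by apply/funext => s; rewrite fct_sumE.
rewrite [X in is_derive _ _ _ X]
  (_ : _ = \sum_(i < 4) (f t 0 i * dg 0 i + g t 0 i * df 0 i)); last first.
  by rewrite /dot -big_split /=; apply: eq_bigr => i _; ring.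
apply: is_derive_sum => i.
by apply: is_deriveM; exact: is_derive_coord.
Qed.

Lemma is_derive_mulmx (R : realType) (f : R -> 'rV[R]_4) (t : R) df
    (Q : 'M[R]_4) :
  is_derive t 1 f df -> is_derive t 1 (fun s => f s *m Q) (df *m Q).
Proof.
move=> fdf; apply: is_derive_row => i.
have dotQ (u : 'rV_4) : (u *m Q) 0 i = dot u (col i Q)^T.
  by rewrite mxE; apply: eq_bigr => j _; rewrite !mxE.
rewrite dotQ; under [X in is_derive _ _ X]eq_fun do rewrite dotQ.
apply: is_derive_eq; first exact: (is_derive_dot fdf (is_derive_cst _ _ _)).
by rewrite -(scale0r (0 : 'rV_4)) dotZr mul0r addr0.
Qed.

(** This is how an identity valid only on [I] gets differentiated: [I] is open, so the identity
    holds near [t]. *)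
Lemma is_derive_eq_on (R : realType) (V : normedModType R) (I : set R)
    (f g : R -> V) (t : R) df dg :
  open I -> I t -> (forall s, I s -> f s = g s) ->
  is_derive t 1 f df -> is_derive t 1 g dg -> df = dg.
Proof.
move=> oI It fg fdf gdg.
have fdg : is_derive t 1 f dg.
  apply: near_eq_is_derive gdg; near=> s; apply/esym/fg; near: s.
  exact: open_nbhs_nbhs.
by rewrite -(@derive_val _ _ _ _ _ _ _ fdf) (@derive_val _ _ _ _ _ _ _ fdg).
Unshelve. all: by end_near. Qed.

Lemma is_derive0_interval (R : realType) (I : set R) (f : R -> R) :
  is_interval I -> (forall t : R, I t -> is_derive t 1 f 0) ->
  forall s t, I s -> I t -> f s = f t.
Proof.
move=> iI f0 s t Is It; wlog st : s t Is It / s <= t => [H|].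
  by case: (leP s t) => [/H|/ltW /H]->.
have Ist x : s <= x <= t -> I x by exact: iI.
have [x||] := @MVT_segment _ f (cst 0) s t st.
- by rewrite in_itv /= => /andP[sx xt]; apply/f0/Ist; rewrite !ltW.
- apply: derivable_within_continuous => x; rewrite in_itv /= => /Ist /f0.
  by case.
- by move=> x _ /eqP; rewrite mul0r subr_eq0 => /eqP ->.
Qed.

(** Covers in one notion the iterated derivatives of a curve smooth only on [I], the closed formulas
    of the model, and scalar coordinates of differences. *)
Definition jet_on (R : realType) (V : normedModType R) (I : set R)
    (g : nat -> R -> V) :=
  forall n (t : R), I t -> is_derive t 1 (g n) (g n.+1 t).

Lemma smooth_jet_on (R : realType) (A : set 'rV[R]_4) I
    (gamma : R -> 'rV[R]_4) :
  smooth_curve_in A I gamma -> jet_on I (fun n => derive1n n gamma).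
Proof.
move=> sm n t It; apply: DeriveDef; first by have [_] := sm t It; apply.
by rewrite derive1nS derive1E.
Qed.

Lemma derive1n_jet (R : realType) (V : normedModType R) (g : nat -> R -> V) n :
  jet_on setT g -> derive1n n (g 0%N) = g n.
Proof.
move=> jg; elim: n => [//|n IH]; rewrite derive1nS IH.
apply/funext => t; rewrite derive1E; apply: derive_val; exact: jg.
Qed.

(* The conserved energies of [y'' + b y] and [y'' + a y], which solve
   [z'' + a z = 0] and [z'' + b z = 0], vanish; so do [y'] and [y'' + a y]. *)
Lemma ode4_unique (R : realType) (I : set R) (y : nat -> R -> R)
    (a b t0 : R) :
  is_interval I -> 0 <= a -> a < b -> jet_on I y ->
  (forall t, I t -> y 4%N t = - (a + b) * y 2%N t - a * b * y 0%N t) ->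
  I t0 -> (forall n, (n < 4)%N -> y n t0 = 0) ->
  forall t, I t -> y 0%N t = 0.
Proof.
move=> iI a0 ab jy ode It0 y0 t It.
pose z c n := fun t => y n.+2 t + c * y n t.
pose E := fun t => z a 1%N t ^+ 2 + b * z a 0%N t ^+ 2 +
                   (z b 1%N t ^+ 2 + a * z b 0%N t ^+ 2).
have zd c n s : I s -> is_derive s 1 (z c n) (z c n.+1 s).
  move=> Is; apply: is_deriveD; first exact: jy.
  by apply: is_deriveZ; exact: jy.
have Ed s : I s -> is_derive s 1 E 0.
  move=> Is; have ? := zd a 0%N s Is; have ? := zd a 1%N s Is.
  have ? := zd b 0%N s Is; have ? := zd b 1%N s Is.
  apply: is_derive_eq.
  by rewrite /GRing.scale /= /z ode //; ring.
(* The energy of [z b] weights [z b 0] by [a], which may be 0, so nothing is claimed about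
   [z b 0]. *)
have E0 s : I s -> z a 1%N s = 0 /\ z b 1%N s = 0 /\ z a 0%N s = 0.
  move=> Is; have : E s = 0.
    rewrite (is_derive0_interval iI Ed Is It0) /E /z !y0 //; ring.
  rewrite /E; set p := z a 1%N s; set q := z a 0%N s; set p' := z b 1%N s.
  set q' := z b 0%N s => Epq.
  have := sqr_ge0 p; have := sqr_ge0 p'.
  have := mulr_ge0 a0 (sqr_ge0 q'). 
  have b0 : 0 < b by lra.
  have := mulr_ge0 (ltW b0) (sqr_ge0 q) => h1 h2 h3 h4.
  have /eqP : p ^+ 2 = 0 by lra.
  have /eqP : p' ^+ 2 = 0 by lra.
  have /eqP : b * q ^+ 2 = 0 by lra.
  by rewrite mulf_eq0 gt_eqF //= !sqrf_eq0 => /eqP-> /eqP-> /eqP->.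
have yd s : I s -> is_derive s 1 (y 0%N) 0.
  move=> Is; have [z1 [z2 _]] := E0 s Is.
  rewrite -[0](_ : y 1%N s = 0); first exact: jy.
  (* The derivatives of [y'' + b y] and [y'' + a y] differ by [(b - a) y']; here [a < b] enters. *)
  have : (b - a) * y 1%N s = 0 by rewrite -[RHS](subrr 0) -{1}z2 -z1 /z; ring.
  by move/eqP; rewrite mulf_eq0 subr_eq0 gt_eqF //= => /eqP.
by rewrite (is_derive0_interval iI yd It It0) y0.
Qed.

(** * Frenet invariants of curves in S^3 *)

Lemma jet_is_derive_dot (R : realType) (I : set R)
    (g : nat -> R -> 'rV[R]_4) m n t :
  jet_on I g -> I t ->
  is_derive t 1 (fun s => dot (g m s) (g n s))
    (dot (g m.+1 t) (g n t) + dot (g m t) (g n.+1 t)).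
Proof. by move=> jg It; apply: is_derive_dot; apply: jg. Qed.

(** Leibniz rule for a constant product: a derivative passes to the other factor with a change of
    sign. *)
Lemma jet_dot_cst (R : realType) (I : set R) (g : nat -> R -> 'rV[R]_4) m n c :
  open I -> jet_on I g -> (forall t, I t -> dot (g m t) (g n t) = c) ->
  forall t, I t -> dot (g m t) (g n.+1 t) = - dot (g m.+1 t) (g n t).
Proof.
move=> oI jg gc t It; apply/eqP; rewrite -addr_eq0 addrC; apply/eqP.
exact: is_derive_eq_on oI It gc (jet_is_derive_dot m n jg It)
  (is_derive_cst _ _ _).
Qed.

Lemma unit_speed_dots (R : realType) (I : set R) (gamma : R -> 'rV[R]_4) :
  open I -> smooth_curve_in (@S3 R) I gamma ->
  (forall t, I t -> enorm (derive1 gamma t) = 1) ->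
  let g n t := derive1n n gamma t in
  forall t, I t ->
  [/\ dot (g 0%N t) (g 0%N t) = 1, dot (g 1%N t) (g 1%N t) = 1,
      dot (g 0%N t) (g 1%N t) = 0
    & [/\ dot (g 1%N t) (g 2%N t) = 0, dot (g 0%N t) (g 2%N t) = - 1
    & dot (g 0%N t) (g 3%N t) = 0]].
Proof.
move=> oI sm us g; have jg : jet_on I g := smooth_jet_on sm.
have D00 t (It : I t) : dot (g 0%N t) (g 0%N t) = 1.
  by apply/S3E; case: (sm t It).
have D11 t (It : I t) : dot (g 1%N t) (g 1%N t) = 1.
  by rewrite -enorm_sqr us // expr1n.
have D01 t (It : I t) : dot (g 0%N t) (g 1%N t) = 0.
  by have := jet_dot_cst oI jg D00 It; rewrite [dot (g 1%N t) _]dotC; lra.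
have D12 t (It : I t) : dot (g 1%N t) (g 2%N t) = 0.
  by have := jet_dot_cst oI jg D11 It; rewrite [dot (g 2%N t) _]dotC; lra.
have D02 t (It : I t) : dot (g 0%N t) (g 2%N t) = - 1.
  by rewrite (jet_dot_cst oI jg D01 It) D11.
have D03 t (It : I t) : dot (g 0%N t) (g 3%N t) = 0.
  by rewrite (jet_dot_cst oI jg D02 It) D12 // oppr0.
by move=> t It; split; [exact: D00|exact: D11|exact: D01|];
  split; [exact: D12|exact: D02|exact: D03].
Qed.

Lemma covD_velocity (R : realType) (I : set R) (gamma : R -> 'rV[R]_4) t :
  open I -> smooth_curve_in (@S3 R) I gamma ->
  (forall t, I t -> enorm (derive1 gamma t) = 1) -> I t ->
  covD gamma (derive1 gamma) t = derive1n 2 gamma t + gamma t.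
Proof.
move=> oI sm us It; have [_ _ _ [_ D02 _]] := unit_speed_dots oI sm us It.
by rewrite /covD [dot _ _]dotC D02 scaleN1r opprK.
Qed.

Lemma curvature_sqr (R : realType) (I : set R) (gamma : R -> 'rV[R]_4) t :
  open I -> smooth_curve_in (@S3 R) I gamma ->
  (forall t, I t -> enorm (derive1 gamma t) = 1) -> I t ->
  curvature gamma t ^+ 2 = dot (derive1n 2 gamma t) (derive1n 2 gamma t) - 1.
Proof.
move=> oI sm us It; rewrite /curvature (covD_velocity oI sm us It) enorm_sqr.
have [D00 _ _ [_ D02 _]] := unit_speed_dots oI sm us It.
by rewrite !dot_lin [dot (derive1n 2 _ _) (gamma t)]dotC D00 D02; ring.
Qed.

(** The vector whose length is the torsion is [kappa^-1] times [g3 + (kappa ^+ 2 + 1) *: g1], and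
    [dot g1 g3] is [- (kappa ^+ 2 + 1)]. *)
Lemma torsion_sqr (R : realType) (I : set R) (gamma : R -> 'rV[R]_4) kappa t :
  open I -> smooth_curve_in (@S3 R) I gamma ->
  (forall t, I t -> enorm (derive1 gamma t) = 1) ->
  (forall t, I t -> curvature gamma t = kappa) -> kappa != 0 -> I t ->
  kappa ^+ 2 * torsion gamma t ^+ 2 =
  dot (derive1n 3 gamma t) (derive1n 3 gamma t) - (kappa ^+ 2 + 1) ^+ 2.
Proof.
move=> oI sm us ck k0 It; have jg := smooth_jet_on sm.
have [D00 D11 D01 [D12 D02 D03]] := unit_speed_dots oI sm us It.
have dN : derive1 (normalN gamma) t =
    kappa^-1 *: (derive1n 3 gamma t + derive1n 1 gamma t).
  rewrite derive1E.
  rewrite (@near_eq_derive _ _ _ _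
    (fun s => kappa^-1 *: (derive1n 2 gamma s + gamma s))).
    apply: derive_val; apply: is_deriveZ; apply: is_deriveD; first exact: jg.
    exact: (jg 0%N).
  near=> s; have Is : I s by near: s; exact: open_nbhs_nbhs.
  by rewrite /normalN ck // (covD_velocity oI sm us Is).
have D13 : dot (derive1n 1 gamma t) (derive1n 3 gamma t) = - (kappa ^+ 2 + 1).
  have D12f s : I s -> dot (derive1n 1 gamma s) (derive1n 2 gamma s) = 0.
    by move=> Is; have [_ _ _ []] := unit_speed_dots oI sm us Is.
  have -> : _ = - dot (derive1n 2 gamma t) (derive1n 2 gamma t) :=
    jet_dot_cst oI jg D12f It.
  by rewrite -(ck _ It) (curvature_sqr oI sm us It) subrK.
have D01' : dot (gamma t) (derive1n 1 gamma t) = 0 := D01.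
have D03' : dot (gamma t) (derive1n 3 gamma t) = 0 := D03.
rewrite /torsion ck // (negPf k0) enorm_sqr /covD dN.
rewrite -[derive1 gamma t]/(derive1n 1 gamma t).
move: D11 D01' D03' D13; set g1 := derive1n 1 gamma t.
set g3 := derive1n 3 gamma t => D11 D01' D03' D13.
(* The derivative of the normal is already tangent to the sphere, so [covD] subtracts nothing. *)
have -> : dot (kappa^-1 *: (g3 + g1)) (gamma t) = 0.
  by rewrite dotZl dotDl ![dot _ (gamma t)]dotC D01' D03' addr0 mulr0.
rewrite scale0r subr0.
by rewrite !dot_lin [dot g3 g1]dotC D13 D11; field.
Unshelve. all: by end_near. Qed.

(** The last diagonal entry is the one dictated by [torsion_sqr]; entries with [i + j] odd vanish
    because the squared lengths are constant. *)
Definition helix_gram (R : realType) (kappa tau : R) (i j : nat) : R :=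
  let m := kappa ^+ 2 + 1 in
  (nth [::] [:: [:: 1; 0; -1; 0];
                [:: 0; 1; 0; - m];
                [:: -1; 0; m; 0];
                [:: 0; - m; 0; m ^+ 2 + kappa ^+ 2 * tau ^+ 2]] i)`_j.

(** Repeated use of [jet_dot_cst] fills in the off-diagonal entries. Stated for jets so as to serve
    both an arbitrary helix and the model. *)
Lemma jet_helix_gram (R : realType) (kappa tau : R) (I : set R)
    (g : nat -> R -> 'rV[R]_4) :
  open I -> jet_on I g ->
  (forall t, I t -> dot (g 0%N t) (g 0%N t) = 1) ->
  (forall t, I t -> dot (g 1%N t) (g 1%N t) = 1) ->
  (forall t, I t -> dot (g 2%N t) (g 2%N t) = kappa ^+ 2 + 1) ->
  (forall t, I t -> dot (g 3%N t) (g 3%N t) =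
    (kappa ^+ 2 + 1) ^+ 2 + kappa ^+ 2 * tau ^+ 2) ->
  forall t i j, I t -> (i < 4)%N -> (j < 4)%N ->
  dot (g i t) (g j t) = helix_gram kappa tau i j.
Proof.
move=> oI jg D00 D11 D22 D33.
have half n c : (forall t, I t -> dot (g n t) (g n t) = c) ->
    forall t, I t -> dot (g n t) (g n.+1 t) = 0.
  move=> Dn t It; have := jet_dot_cst oI jg Dn It.
  by rewrite [dot (g n.+1 t) _]dotC; lra.
have D01 := half _ _ D00; have D12 := half _ _ D11; have D23 := half _ _ D22.
have D02 t (It : I t) : dot (g 0%N t) (g 2%N t) = - 1.
  by rewrite (jet_dot_cst oI jg D01 It) D11.
have D03 t (It : I t) : dot (g 0%N t) (g 3%N t) = 0.
  by rewrite (jet_dot_cst oI jg D02 It) D12 // oppr0.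
have D13 t (It : I t) : dot (g 1%N t) (g 3%N t) = - (kappa ^+ 2 + 1).
  by rewrite (jet_dot_cst oI jg D12 It) D22.
have sym m n t c : dot (g m t) (g n t) = c -> dot (g n t) (g m t) = c.
  by rewrite dotC.
move=> t i j It; move: i j.
move=> [|[|[|[|//]]]] [|[|[|[|//]]]] _ _; rewrite /helix_gram /=;
  by [auto|apply: sym; auto].
Qed.

(** The matrix [M] with rows [u i] has [M *m M^T] diagonal with nonzero entries, so [M^T] is
    invertible, while [e *m M^T = 0]. *)
Lemma eq0_orthogonal_basis (R : realType) (u : 'I_4 -> 'rV[R]_4)
    (e : 'rV[R]_4) :
  (forall i j, i != j -> dot (u i) (u j) = 0) ->
  (forall i, dot (u i) (u i) != 0) -> (forall i, dot e (u i) = 0) -> e = 0.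
Proof.
move=> uij uii eu; pose M := \matrix_i u i.
have MM : M *m M^T = diag_mx (\row_i dot (u i) (u i)).
  apply/matrixP => i j; rewrite !mxE.
  have [<-|ij] := eqVneq i j.
    by rewrite mulr1n; apply: eq_bigr => k _; rewrite !mxE.
  rewrite mulr0n -[RHS](uij _ _ ij); apply: eq_bigr => k _; by rewrite !mxE.
have uM : M^T \in unitmx.
  have : M *m M^T \in unitmx.
    rewrite MM unitmxE det_diag unitfE; apply/prodf_neq0 => i _; by rewrite mxE.
  by rewrite unitmx_mul => /andP[].
apply: (can_inj (mulmxK uM)); rewrite mul0mx; apply/rowP => i.
by rewrite [RHS]mxE -[RHS](eu i) mxE; apply: eq_bigr => k _; rewrite !mxE.
Qed.

Definition chi2 (R : realType) (kappa tau : R) := kappa ^+ 2 + tau ^+ 2 + 1.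

(* If [tau != 0], the derivatives of order at most 3 are independent, and the
   difference of the two sides is orthogonal to them. *)
Lemma jet_helix_ode (R : realType) (kappa tau : R) (I : set R)
    (g : nat -> R -> 'rV[R]_4) :
  (kappa = 0 -> tau = 0) -> open I -> jet_on I g ->
  (forall t i j, I t -> (i < 4)%N -> (j < 4)%N ->
     dot (g i t) (g j t) = helix_gram kappa tau i j) ->
  forall t, I t ->
  g 4%N t = - chi2 kappa tau *: g 2%N t - tau ^+ 2 *: g 0%N t.
Proof.
move=> kt oI jg D t It.
have [t0|t0] := eqVneq tau 0.
  (* For [tau = 0] the third derivative depends on the first: the Gram matrix gives this combination
     length 0. Differentiating it once yields the equation. *)
  have g31 s : I s -> g 3%N s + (kappa ^+ 2 + 1) *: g 1%N s = 0.
    move=> Is; apply: dot_eq0; rewrite !dot_lin !D //.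
    by rewrite /helix_gram /= t0; ring.
  have g42 : g 4%N t + (kappa ^+ 2 + 1) *: g 2%N t = 0.
    apply: (is_derive_eq_on (g := cst 0) oI It g31).
    apply: is_deriveD; first exact: jg.
    by apply: is_deriveZ; exact: jg.
  move/eqP: g42; rewrite addr_eq0 => /eqP ->.
  by rewrite t0 /chi2 expr0n /= addr0 scale0r subr0 scaleNr.
have k0 : kappa != 0 by apply: contra_neq t0.
(* Products with the fourth derivative come from differentiating those with the third; for [n = 3]
   this forces the value 0. *)
have D3 n : (n < 4)%N ->
    dot (g n t) (g 4%N t) = - dot (g n.+1 t) (g 3%N t).
  by move=> n4; apply: (jet_dot_cst oI jg _ It) => s Is; exact: D.
have D34 : dot (g 3%N t) (g 4%N t) = 0.
  by have := D3 3%N isT; rewrite [dot (g 4%N t) _]dotC; lra.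
apply/eqP; rewrite -subr_eq0; apply/eqP; set e := _ - _.
have e0 n : (n < 4)%N -> dot e (g n t) = 0.
  move=> n4; rewrite /e !dot_lin [dot (g 4%N t) _]dotC.
  move: n n4 => [|[|[|[|//]]]] _;
    rewrite ?D34 ?D3 // !D // /helix_gram /chi2 /=; ring.
clearbody e.
(* Gram-Schmidt applied to the derivatives, without normalisation: the position and the Frenet frame
   up to scale, with squared lengths 1, 1, [kappa ^+ 2] and [(kappa * tau) ^+ 2]. *)
pose u : 'I_4 -> 'rV_4 := fun i => nth 0 [:: g 0%N t; g 1%N t;
  g 2%N t + g 0%N t; g 3%N t + (kappa ^+ 2 + 1) *: g 1%N t] i.
apply: (@eq0_orthogonal_basis _ u).
- by move=> [[|[|[|[|//]]]] ?] [[|[|[|[|//]]]] ?] //= _;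
    rewrite /u /= ?dot_lin ?D // /helix_gram /=; ring.
- move=> [[|[|[|[|//]]]] ?];
    rewrite /u /= ?dot_lin ?D // /helix_gram /= ?oner_eq0 //.
  + rewrite [X in X != 0](_ : _ = kappa ^+ 2); last by ring.
    by rewrite sqrf_eq0.
  + rewrite [X in X != 0](_ : _ = (kappa * tau) ^+ 2); last by ring.
    by rewrite sqrf_eq0 mulf_neq0.
- by move=> [[|[|[|[|//]]]] ?]; rewrite /u /= ?dot_lin !e0 //; ring.
Qed.

Lemma helix_dots (R : realType) (kappa tau : R) (I : set R)
    (gamma : R -> 'rV[R]_4) :
  (kappa = 0 -> tau = 0) -> helix kappa tau I gamma ->
  forall t i j, I t -> (i < 4)%N -> (j < 4)%N ->
  dot (derive1n i gamma t) (derive1n j gamma t) = helix_gram kappa tau i j.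
Proof.
move=> kt [[oI _ _] sm us ck ct].
have jg := smooth_jet_on sm.
have D22 s : I s ->
    dot (derive1n 2 gamma s) (derive1n 2 gamma s) = kappa ^+ 2 + 1.
  by move=> Is; rewrite -(ck _ Is) (curvature_sqr oI sm us Is) subrK.
apply: (jet_helix_gram oI jg) => // t It; cbv beta.
- by case: (unit_speed_dots oI sm us It).
- by case: (unit_speed_dots oI sm us It).
(* [torsion_sqr] requires [kappa != 0]. For [kappa = 0] the curve satisfies [g'' = - g], so the
   third derivative is minus the first. *)
have [k0|k0] := eqVneq kappa 0; last first.
  have := torsion_sqr oI sm us ck k0 It; rewrite ct // => ->.
  by rewrite addrC subrK.
have g20 s : I s -> derive1n 2 gamma s + gamma s = 0.
  move=> Is; apply: dot_eq0; rewrite -(covD_velocity oI sm us Is).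
  have := ck s Is; rewrite k0 /curvature => c0.
  by rewrite -enorm_sqr c0 expr0n.
have g31 : derive1n 3 gamma t + derive1n 1 gamma t = 0.
  apply: (is_derive_eq_on (g := cst 0) oI It g20).
  by apply: is_deriveD; [exact: (jg 2%N)|exact: (jg 0%N)].
have [_ D11 _ _] := unit_speed_dots oI sm us It.
have g3E : derive1n 3 gamma t = - derive1n 1 gamma t.
  by apply/eqP; rewrite -addr_eq0 g31.
by rewrite g3E dotNl dotNr opprK D11 k0 kt //; ring.
Qed.

Lemma helix_ode (R : realType) (kappa tau : R) (I : set R)
    (gamma : R -> 'rV[R]_4) t :
  (kappa = 0 -> tau = 0) -> helix kappa tau I gamma -> I t ->
  derive1n 4 gamma t =
  - chi2 kappa tau *: derive1n 2 gamma t - tau ^+ 2 *: gamma t.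
Proof.
move=> kt hg It; have D := helix_dots kt hg; case: hg => [[oI _ _] sm _ _ _].
exact: jet_helix_ode kt oI (smooth_jet_on sm) D t It.
Qed.

(** * The model helix *)

Definition torus_pt (R : realType) (r1 r2 x y : R) : 'rV[R]_4 :=
  \row_(i < 4) [:: r1 * cos x; r1 * sin x; r2 * cos y; r2 * sin y]`_i.

Lemma dot_torus_pt (R : realType) (r1 r2 x y : R) :
  dot (torus_pt r1 r2 x y) (torus_pt r1 r2 x y) = r1 ^+ 2 + r2 ^+ 2.
Proof.
rewrite dotE !mxE /=.
transitivity (r1 ^+ 2 * (cos x ^+ 2 + sin x ^+ 2) +
              r2 ^+ 2 * (cos y ^+ 2 + sin y ^+ 2)); first by ring.
by rewrite !cos2Dsin2 !mulr1.
Qed.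

(* Differentiation multiplies the radii by the frequencies and shifts the
   phases by [pi / 2]. *)
Definition model_jet (R : realType) (w1 w2 r1 r2 : R) (n : nat) (t : R) :=
  torus_pt (r1 * w1 ^+ n) (r2 * w2 ^+ n)
    (w1 * t + n%:R * (pi / 2)) (w2 * t + n%:R * (pi / 2)).

Lemma model_jet0 (R : realType) (w1 w2 r1 r2 t : R) :
  model_jet w1 w2 r1 r2 0 t = torus_pt r1 r2 (w1 * t) (w2 * t).
Proof. by rewrite /model_jet !expr0 !mulr1 !mul0r !addr0. Qed.

Lemma is_derive_affine (R : realType) (w c t : R) :
  is_derive t 1 (fun s => w * s + c) w.
Proof.
apply: is_derive_eq.
by rewrite addr0 /GRing.scale /= mulr1.
Qed.

Lemma model_jetP (R : realType) (w1 w2 r1 r2 : R) :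
  jet_on setT (model_jet w1 w2 r1 r2).
Proof.
(* Both [cos] and [sin] have their own shift by [pi / 2] as derivative, so one computation serves
   all four coordinates. *)
have wave (f : R -> R) (r w : R) n (t : R) :
    (forall x : R, is_derive x 1 f (f (x + pi / 2))) ->
    is_derive t 1 (fun s => r * w ^+ n * f (w * s + n%:R * (pi / 2)))
      (r * w ^+ n.+1 * f (w * t + n.+1%:R * (pi / 2))).
  move=> df; have := df (w * t + n%:R * (pi / 2)) => dft.
  have := is_derive_affine w (n%:R * (pi / 2)) t => dwt.
  have dfw : is_derive t 1 (fun s => f (w * s + n%:R * (pi / 2))) _ :=
    @is_derive1_comp R f (fun s => w * s + n%:R * (pi / 2)) t _ _ dft dwt.
  have -> : r * w ^+ n.+1 * f (w * t + n.+1%:R * (pi / 2)) =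
    r * w ^+ n * (f (w * t + n%:R * (pi / 2) + pi / 2) * w); last first.
    by apply: is_deriveZ.
  have -> : w * t + n.+1%:R * (pi / 2) = w * t + n%:R * (pi / 2) + pi / 2.
    by rewrite -natr1; ring.
  by rewrite exprSr; ring.
have dcos (x : R) : is_derive x 1 (@cos R) (cos (x + pi / 2)).
  by rewrite cosDpihalf; exact: is_derive_cos.
have dsin (x : R) : is_derive x 1 (@sin R) (sin (x + pi / 2)).
  by rewrite sinDpihalf; exact: is_derive_sin.
move=> n t _; apply: is_derive_row => i; rewrite mxE.
under [X in is_derive _ _ X]eq_fun do rewrite mxE.
by move: i => [[|[|[|[|//]]]] ?] /=; exact: wave.
Qed.

Lemma model_jet_dot (R : realType) (w1 w2 r1 r2 : R) n t :
  dot (model_jet w1 w2 r1 r2 n t) (model_jet w1 w2 r1 r2 n t) =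
  r1 ^+ 2 * (w1 ^+ 2) ^+ n + r2 ^+ 2 * (w2 ^+ 2) ^+ n.
Proof. by rewrite dot_torus_pt !exprMn -!expr2. Qed.

Definition discr (R : realType) (kappa tau : R) :=
  Num.sqrt (chi2 kappa tau ^+ 2 - 4 * tau ^+ 2).
Definition freq1 (R : realType) (kappa tau : R) :=
  Num.sqrt ((chi2 kappa tau - discr kappa tau) / 2).
Definition freq2 (R : realType) (kappa tau : R) :=
  Num.sqrt ((chi2 kappa tau + discr kappa tau) / 2).
(** Cramer's rule for the two linear conditions on the squared radii; the determinant is [discr],
    the difference of the squared frequencies. *)
Definition radius1 (R : realType) (kappa tau : R) :=
  Num.sqrt ((freq2 kappa tau ^+ 2 - 1) / discr kappa tau).
Definition radius2 (R : realType) (kappa tau : R) :=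
  Num.sqrt ((1 - freq1 kappa tau ^+ 2) / discr kappa tau).

Lemma discrP (R : realType) (kappa tau : R) :
  (kappa = 0 -> tau = 0) ->
  [/\ 0 < discr kappa tau, discr kappa tau <= chi2 kappa tau
    & discr kappa tau ^+ 2 = chi2 kappa tau ^+ 2 - 4 * tau ^+ 2].
Proof.
move=> kt; have k2 := sqr_ge0 kappa; have t2 := sqr_ge0 tau.
have d2 : 0 < chi2 kappa tau ^+ 2 - 4 * tau ^+ 2.
  (* The factors are chi^2 - 2 tau and chi^2 + 2 tau, written as sums of squares. *)
  rewrite (_ : _ - _ = (kappa ^+ 2 + (tau - 1) ^+ 2) *
                       (kappa ^+ 2 + (tau + 1) ^+ 2)); last first.
    by rewrite /chi2; ring.
  have [k0|k0] := eqVneq kappa 0.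
    by rewrite k0 kt // expr0n /= !add0r expr1n sqrrN expr1n mulr1.
  have {}k2 : 0 < kappa ^+ 2 by rewrite lt_def sqrf_eq0 k0.
  by rewrite mulr_gt0 // ltr_pwDl // sqr_ge0.
have c0 : 0 <= chi2 kappa tau by rewrite /chi2; lra.
split; rewrite /discr ?sqrtr_gt0 //; last by rewrite sqr_sqrtr // ltW.
rewrite -[leRHS](ger0_norm c0) -sqrtr_sqr ler_sqrt ?sqr_ge0 //; lra.
Qed.

Lemma freqP (R : realType) (kappa tau : R) (kt : kappa = 0 -> tau = 0) :
  let w1 := freq1 kappa tau in let w2 := freq2 kappa tau in
  [/\ 0 <= w1, w1 < w2, w2 ^+ 2 - w1 ^+ 2 = discr kappa tau,
      w1 ^+ 2 + w2 ^+ 2 = chi2 kappa tau & w1 ^+ 2 * w2 ^+ 2 = tau ^+ 2].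
Proof.
have [d0 dc d2] := discrP kt; have k2 := sqr_ge0 kappa; have t2 := sqr_ge0 tau.
have c0 : 0 < chi2 kappa tau by rewrite /chi2; lra.
rewrite /freq1 /freq2 !sqr_sqrtr; try by lra.
split; rewrite ?sqrtr_ge0 //; [|lra|lra|].
  by rewrite ltr_sqrt; lra.
by apply: (mulfI (x := 4)); rewrite ?pnatr_eq0 //; lra.
Qed.

(** The polynomial X^2 - chi^2 X + tau^2 takes the value [- kappa ^+ 2] at 1. Hence 1 lies between
    the squared frequencies, strictly if [kappa != 0], which gives the signs of the radicands. *)
Lemma radiusP (R : realType) (kappa tau : R) (kt : kappa = 0 -> tau = 0) :
  let w1 := freq1 kappa tau in let w2 := freq2 kappa tau in
  let r1 := radius1 kappa tau in let r2 := radius2 kappa tau in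
  [/\ r1 ^+ 2 + r2 ^+ 2 = 1, r1 ^+ 2 * w1 ^+ 2 + r2 ^+ 2 * w2 ^+ 2 = 1
    & kappa != 0 -> 0 < r1 /\ 0 < r2].
Proof.
move=> w1 w2 r1 r2; have [d0 _ _] := discrP kt.
have [w10 w12 wd ws wp] := freqP kt.
rewrite -/w1 -/w2 in w10 w12 wd ws wp.
have prod : (1 - w1 ^+ 2) * (w2 ^+ 2 - 1) = kappa ^+ 2.
  have -> : kappa ^+ 2 = chi2 kappa tau - tau ^+ 2 - 1 by rewrite /chi2; ring.
  by rewrite -ws -wp; ring.
have k2 := sqr_ge0 kappa.
have w1le : w1 ^+ 2 <= 1 by rewrite leNgt; apply/negP => h; nra.
have w2ge : 1 <= w2 ^+ 2 by rewrite leNgt; apply/negP => h; nra.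
have r1E : r1 ^+ 2 = (w2 ^+ 2 - 1) / discr kappa tau.
  by rewrite sqr_sqrtr // divr_ge0 ?subr_ge0 // ltW.
have r2E : r2 ^+ 2 = (1 - w1 ^+ 2) / discr kappa tau.
  by rewrite sqr_sqrtr // divr_ge0 ?subr_ge0 // ltW.
rewrite r1E r2E -wd; rewrite -wd in d0.
have dn : w2 ^+ 2 - w1 ^+ 2 != 0 by rewrite gt_eqF.
split; [by field|by field|move=> k0].
have {}k2 : 0 < kappa ^+ 2 by rewrite lt_def sqrf_eq0 k0.
rewrite -prod in k2; split; rewrite sqrtr_gt0 divr_gt0 // -?wd //.
  by rewrite lt_def subr_ge0 w2ge andbT; apply: contraTneq k2 => ->;
    rewrite mulr0 ltxx.
by rewrite lt_def subr_ge0 w1le andbT; apply: contraTneq k2 => ->;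
  rewrite mul0r ltxx.
Qed.

Definition model_helix (R : realType) (kappa tau : R) (n : nat) (t : R) :=
  model_jet (freq1 kappa tau) (freq2 kappa tau)
    (radius1 kappa tau) (radius2 kappa tau) n t.

(** The squared lengths s_n of the derivatives satisfy s_(n+2) = chi^2 s_(n+1) - tau^2 s_n, because
    the squared frequencies are the roots of X^2 - chi^2 X + tau^2; the radii are chosen so that s_0
    = s_1 = 1. *)
Lemma model_helix_gram (R : realType) (kappa tau : R) t i j :
  (kappa = 0 -> tau = 0) -> (i < 4)%N -> (j < 4)%N ->
  dot (model_helix kappa tau i t) (model_helix kappa tau j t) =
  helix_gram kappa tau i j.
Proof.
move=> kt i4 j4; have [_ _ _ ws wp] := freqP kt; have [r0 r1 _] := radiusP kt.
set w1 := freq1 kappa tau in ws wp r1; set w2 := freq2 kappa tau in ws wp r1.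
set p1 := radius1 kappa tau in r0 r1; set p2 := radius2 kappa tau in r0 r1.
have r2 : p1 ^+ 2 * (w1 ^+ 2) ^+ 2 + p2 ^+ 2 * (w2 ^+ 2) ^+ 2 = kappa ^+ 2 + 1.
  transitivity ((w1 ^+ 2 + w2 ^+ 2) * (p1 ^+ 2 * w1 ^+ 2 + p2 ^+ 2 * w2 ^+ 2) -
    w1 ^+ 2 * w2 ^+ 2 * (p1 ^+ 2 + p2 ^+ 2)); first by ring.
  by rewrite ws wp r0 r1 /chi2; ring.
have oT : open [set: R] := openT.
apply: (jet_helix_gram oT (@model_jetP R w1 w2 p1 p2)) => // s _;
  rewrite model_jet_dot.
- by rewrite !expr0 !mulr1.
- by rewrite !expr1.
- by [].
transitivity ((w1 ^+ 2 + w2 ^+ 2) *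
    (p1 ^+ 2 * (w1 ^+ 2) ^+ 2 + p2 ^+ 2 * (w2 ^+ 2) ^+ 2) -
    w1 ^+ 2 * w2 ^+ 2 * (p1 ^+ 2 * w1 ^+ 2 + p2 ^+ 2 * w2 ^+ 2)); first by ring.
by rewrite ws wp r1 r2 /chi2; ring.
Qed.

Lemma open_intervalT (R : realType) : open_interval [set: R].
Proof. by split; [exact: openT| |exists 0]. Qed.

Lemma model_derive1n (R : realType) (kappa tau : R) (Q : 'M[R]_4) n :
  derive1n n (fun t => model_helix kappa tau 0 t *m Q) =
  (fun t => model_helix kappa tau n t *m Q).
Proof.
apply: (@derive1n_jet _ _ (fun n t => model_helix kappa tau n t *m Q)).
by move=> m t _; apply: is_derive_mulmx; exact: model_jetP.
Qed.

(** Reads curvature and torsion back from the Gram matrix; being nonnegative, they are determined by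
    their squares. *)
Lemma model_is_helix (R : realType) (kappa tau : R) (Q : 'M[R]_4) :
  0 <= kappa -> 0 <= tau -> (kappa = 0 -> tau = 0) -> isometry_mx Q ->
  helix kappa tau setT (fun t => model_helix kappa tau 0 t *m Q).
Proof.
move=> k0 t0 kt QQ; set gamma := fun t => _.
have gn n : derive1n n gamma = (fun t => model_helix kappa tau n t *m Q).
  exact: model_derive1n.
have D t i j : (i < 4)%N -> (j < 4)%N ->
    dot (derive1n i gamma t) (derive1n j gamma t) = helix_gram kappa tau i j.
  by move=> i4 j4; rewrite !gn isometry_mx_dot // model_helix_gram.
have oT : open [set: R] := openT.
have sm : smooth_curve_in (@S3 R) setT gamma.
  move=> t _; split; first by apply/S3E; exact: (D t 0%N 0%N).
  move=> n; rewrite gn.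
  by have [] := is_derive_mulmx Q (@model_jetP R (freq1 kappa tau)
    (freq2 kappa tau) (radius1 kappa tau) (radius2 kappa tau) n t I).
have us t : setT t -> enorm (derive1 gamma t) = 1.
  by move=> _; apply: enorm_eq => //; rewrite expr1n; exact: (D t 1%N 1%N).
have ck t : setT t -> curvature gamma t = kappa.
  move=> tT; apply/eqP; rewrite -(@eqrXn2 _ 2) ?sqrtr_ge0 //.
  by rewrite (curvature_sqr oT sm us tT) D // /helix_gram /= addrK.
split => // [|t tT]; first exact: open_intervalT.
have [kz|kz] := eqVneq kappa 0.
  by rewrite /torsion ck // kz eqxx kt.
have := torsion_sqr oT sm us ck kz tT; rewrite D // /helix_gram /=.
rewrite addrAC subrr add0r => /mulfI tt.
apply/eqP; rewrite -(@eqrXn2 _ 2) ?tt ?sqrf_eq0 //.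
by rewrite /torsion ck // (negPf kz) sqrtr_ge0.
Qed.

(** Each coordinate of the difference satisfies [ode4_unique] with the squared frequencies as [a]
    and [b]. *)
Lemma helix_unique (R : realType) (kappa tau : R) (I : set R)
    (alpha beta : R -> 'rV[R]_4) t0 :
  (kappa = 0 -> tau = 0) -> helix kappa tau I alpha -> helix kappa tau I beta ->
  I t0 ->
  (forall n, (n < 4)%N -> derive1n n alpha t0 = derive1n n beta t0) ->
  forall t, I t -> alpha t = beta t.
Proof.
move=> kt ha hb It0 ab0 t It; apply/rowP => i; apply/eqP; rewrite -subr_eq0.
apply/eqP; have [w10 w12 _ ws wp] := freqP kt.
pose y n s := derive1n n alpha s 0 i - derive1n n beta s 0 i.
have := @ode4_unique _ I y (freq1 kappa tau ^+ 2) (freq2 kappa tau ^+ 2) t0.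
have oda := helix_ode kt ha; have odb := helix_ode kt hb.
case: ha => [[_ iI _] sma _ _ _]; case: hb => [_ smb _ _ _].
apply => //.
- exact: sqr_ge0.
- by rewrite ltrXn2r // (le_lt_trans w10).
- move=> n s Is; apply: is_deriveB; apply: is_derive_coord.
    exact: (smooth_jet_on sma).
  exact: (smooth_jet_on smb).
- move=> s Is; rewrite ws wp.
  have lin (p p2 p0 q q2 q0 : R) :
      p = - chi2 kappa tau * p2 - tau ^+ 2 * p0 ->
      q = - chi2 kappa tau * q2 - tau ^+ 2 * q0 ->
      p - q = - chi2 kappa tau * (p2 - q2) - tau ^+ 2 * (p0 - q0).
    by move=> -> ->; ring.
  apply: lin.
    by have /(congr1 (fun M : 'rV_4 => M 0 i)) := oda s Is; rewrite !mxE.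
  by have /(congr1 (fun M : 'rV_4 => M 0 i)) := odb s Is; rewrite !mxE.
- by move=> n n4; rewrite /y ab0 // subrr.
Qed.

Lemma helix_sub (R : realType) (kappa tau : R) (I J : set R)
    (gamma : R -> 'rV[R]_4) :
  open_interval I -> I `<=` J -> helix kappa tau J gamma ->
  helix kappa tau I gamma.
Proof. by move=> oI IJ [_ sm us ck ct]; split=> // t /IJ; auto. Qed.

Lemma helix_normal_form (R : realType) (kappa tau : R) (I : set R)
    (gamma : R -> 'rV[R]_4) :
  0 <= kappa -> 0 <= tau -> (kappa = 0 -> tau = 0) -> helix kappa tau I gamma ->
  exists2 Q, isometry_mx Q &
    forall t, I t -> gamma t = model_helix kappa tau 0 t *m Q.
Proof.
move=> k0 t0 kt hg; have [oI _ _ _ _] := hg; have [_ _ [s Is]] := oI.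
(* The Gram matrix of the model is the same at all times, so the two jets can be matched at the same
   parameter [s], without a shift. *)
have [i j i4 j4|Q QQ gQ] := @gram_ortho _ 4 (fun n => model_helix kappa tau n s)
    (fun n => derive1n n gamma s).
  by rewrite model_helix_gram // (helix_dots kt hg).
exists Q => //.
have hm := helix_sub oI (@subsetT _ I) (model_is_helix k0 t0 kt QQ).
by apply: (helix_unique kt hg hm Is) => n n4; rewrite model_derive1n -gQ.
Qed.

(** * Linear isometries *)

Lemma differentiable_mulmx (R : realType) (Q : 'M[R]_4) (x : 'rV[R]_4) :
  differentiable (fun x : 'rV[R]_4 => x *m Q) x.
Proof.
rewrite (_ : (fun x : 'rV[R]_4 => _) =
  \sum_(i < 4) (fun x : 'rV[R]_4 => x 0 i *: row i Q)); last first.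
  by apply/funext => y; rewrite fct_sumE mulmx_sum_row.
apply: differentiable_sum => i; apply: differentiableZl.
exact: differentiable_coord.
Qed.

Lemma derive_mulmx (R : realType) (Q : 'M[R]_4) (v x : 'rV[R]_4) :
  'D_v (fun x : 'rV[R]_4 => x *m Q) x = v *m Q.
Proof.
have dQ := differentiable_mulmx Q; rewrite deriveE //.
rewrite (@diff_lin _ _ _ (mulmxr Q)) // => y.
exact: differentiable_continuous.
Qed.

Lemma smooth_map_mulmx (R : realType) (A : set 'rV[R]_4) (Q : 'M[R]_4) :
  smooth_map A (fun x => x *m Q).
Proof.
move=> p Ap; exists setT, (fun x => x *m Q); split=> //.
  by split; [exact: openT|].
move=> vs x _.
(* One directional derivative of a linear map is constant, and all further ones are 0. *)
have [->|[c ->]] : foldr (fun v G => 'D_v G) (fun x : 'rV[R]_4 => x *m Q) vs =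
    (fun x => x *m Q) \/
    exists c, foldr (fun v G => 'D_v G) (fun x : 'rV[R]_4 => x *m Q) vs = cst c.
- elim: vs => [|v vs IH]; [by left|right => /=].
  case: IH => [->|[c ->]]; [exists (v *m Q)|exists 0]; apply/funext => y.
    exact: derive_mulmx.
  exact: derive_cst.
- exact: differentiable_mulmx.
- exact: differentiable_cst.
Qed.

(** The set [A] is arbitrary: the sphere for congruence, a product of circles for the torus. *)
Lemma mulmx_isometry (R : realType) (A : set 'rV[R]_4) (Q : 'M[R]_4) :
  isometry_mx Q ->
  riemannian_isometry A [set x *m Q | x in A] (fun x => x *m Q).
Proof.
move=> QQ; split.
- split.
  + by move=> x Ax; exists x.
  + by move=> x y _ _ /(congr1 (mulmxr Q^T)) /=; rewrite !isometry_mxK.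
  + by [].
- exact: smooth_map_mulmx.
- exists (fun x => x *m Q^T); split; first exact: smooth_map_mulmx.
  by move=> x _; rewrite isometry_mxK.
- move=> I c d [_ I0] sc sd _.
  have dQ e : smooth_curve_in A I e ->
      derive1 ((fun x => x *m Q) \o e) 0 = derive1 e 0 *m Q.
    move=> se; rewrite derive1E; apply: derive_val.
    apply: is_derive_mulmx; exact: (smooth_jet_on se 0%N I0).
  by rewrite !dQ // isometry_mx_dot.
Qed.

Lemma image_S3 (R : realType) (Q : 'M[R]_4) :
  isometry_mx Q -> [set x *m Q | x in @S3 R] = @S3 R.
Proof.
move=> QQ; apply/seteqP; split=> [_ [x /S3E xx <-]|x /S3E xx].
  by apply/S3E; rewrite isometry_mx_dot.
exists (x *m Q^T); last first.
  by rewrite -[RHS](isometry_mxK _ (isometry_mx_tr QQ)) trmxK.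
by apply/S3E; rewrite isometry_mx_dot //; exact: isometry_mx_tr.
Qed.

(** * Angles modulo 2 pi *)

Lemma cosD2piz (R : realType) (x : R) (k : int) :
  cos (x + k%:~R * (2 * pi)) = cos x.
Proof.
have nat_case (n : nat) y : cos (y + n%:R * (2 * pi)) = cos y :> R.
  rewrite -[RHS](periodicn (@cosD2pi R) n y); congr (cos (_ + _)).
  by rewrite -[RHS]mulr_natl -[pi *+ 2]mulr_natl.
case: k => n; first exact: nat_case.
by rewrite NegzE -(nat_case n.+1) mulrNz mulNr subrK.
Qed.

Lemma sinD2piz (R : realType) (x : R) (k : int) :
  sin (x + k%:~R * (2 * pi)) = sin x.
Proof.
by rewrite -!cosBpihalf -[RHS](cosD2piz _ k); congr cos; ring.
Qed.

(** Reduce [x] to [y] in [0, 2 pi); then 1 - cos y = 2 sin(y/2)^2 is positive unless y = 0. *)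
Lemma cos_eq1 (R : realType) (x : R) :
  cos x = 1 -> exists k : int, x = k%:~R * (2 * pi).
Proof.
move=> cx; exists (Num.floor (x / (2 * pi))); set k := Num.floor _.
have pi2 : 0 < 2 * pi :> R by rewrite mulr_gt0 ?pi_gt0.
pose y := x - k%:~R * (2 * pi).
have y0 : 0 <= y.
  by rewrite subr_ge0 -ler_pdivlMr // floor_le.
have y1 : y < 2 * pi.
  rewrite ltrBlDl -[X in _ + X]mul1r -mulrDl -ltr_pdivrMr //.
  by have := floorD1_gt (x / (2 * pi)); rewrite intrD.
have cy : cos y = 1 by rewrite /y -mulNr -mulrNz cosD2piz.
suff y00 : y = 0 by apply/eqP; rewrite -subr_eq0 -/y y00.
apply/eqP; apply: contraT => yn0.
have : 0 < sin (y / 2).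
  apply: sin_gt0_pi; apply/andP; split; last by rewrite ltr_pdivrMr // mulrC.
  by rewrite divr_gt0 // lt_def yn0.
have := cos_mulr2n (y / 2).
rewrite (_ : (y / 2) *+ 2 = y); last by rewrite -mulr_natr divfK ?pnatr_eq0.
rewrite cy cos2sin2.
move=> h1 h2; have := exprn_gt0 2 h2; lra.
Qed.

Lemma polar (R : realType) (a b r : R) : 0 < r -> a ^+ 2 + b ^+ 2 = r ^+ 2 ->
  exists x, a = r * cos x /\ b = r * sin x.
Proof.
move=> r0 abr; have rn : r != 0 by rewrite gt_eqF.
have ar : (a / r) ^+ 2 + (b / r) ^+ 2 = 1.
  by rewrite !expr_div_n -mulrDl abr divff // expf_neq0.
have ai : -1 <= a / r <= 1.
  rewrite -ler_norml -(@ler_sqr _ `|_|) ?nnegrE //.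
  by rewrite expr1n real_normK ?num_real // -ar lerDl sqr_ge0.
have ca : cos (acos (a / r)) = a / r by rewrite acosK.
have sa : sin (acos (a / r)) = `|b / r|.
  by rewrite sin_acos // -ar addrAC subrr add0r sqrtr_sqr.
have [b0|b0] := leP 0 (b / r).
  exists (acos (a / r)); rewrite ca sa ger0_norm //.
  by rewrite !(mulrCA r) !divff // !mulr1.
exists (- acos (a / r)); rewrite cosN sinN ca sa ltr0_norm // opprK.
by rewrite !(mulrCA r) !divff // !mulr1.
Qed.

Lemma irrational_comb_neq0 (R : realType) (rho : R) (n m : int) :
  irrational rho -> n != 0 -> n%:~R * rho + m%:~R != 0.
Proof.
move=> irr n0; apply/negP => /eqP nm; apply: irr.
exists (- m%:~R / n%:~R) => //.
rewrite fmorph_div rmorphN /= !ratr_int.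
have nR : n%:~R != 0 :> R by rewrite intr_eq0.
by apply: (mulfI nR); rewrite mulrC divfK //; lra.
Qed.

(* The remainder of 1 modulo a positive element of [Z rho + Z], or that
   element minus the remainder, is at most half of it. *)
Lemma irrational_comb_small (R : realType) (rho : R) (j : nat) :
  irrational rho -> exists n m : int,
  [/\ n != 0, 0 < n%:~R * rho + m%:~R & n%:~R * rho + m%:~R <= 2 ^- j].
Proof.
move=> irr; elim: j => [|j [n [m [n0]]]].
  (* The fractional part of [rho], nonzero by irrationality. *)
  exists 1, (- Num.floor rho); have := floor_le rho; have := floorD1_gt rho.
  have := @irrational_comb_neq0 _ rho 1 (- Num.floor rho) irr isT.
  rewrite intrD mul1r rmorphN /= => h0 h1 h2; split => //.
    by rewrite lt_def h0 subr_ge0.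
  by rewrite expr0 invr1; lra.
set d := _ + _ => d0 dj.
have d1 : d <= 1.
  by rewrite (le_trans dj) // invf_le1 ?exprn_gt0 // exprn_ege1 // ler1n.
pose k := Num.floor d^-1.
have k1 : 1 <= k by rewrite /k floor_ge_int invf_ge1.
have kd : k%:~R * d <= 1 by rewrite -ler_pdivlMr // mul1r floor_le.
have kd1 : 1 < k%:~R * d + d.
  rewrite -[X in _ + X]mul1r -mulrDl -ltr_pdivrMr // mul1r.
  by have := floorD1_gt d^-1; rewrite intrD.
have rE : 1 - k%:~R * d = (- (k * n))%:~R * rho + (1 - k * m)%:~R.
  by rewrite /d rmorphB rmorphN !rmorphM /=; ring.
have kn0 : - (k * n) != 0.
  by rewrite oppr_eq0 mulf_neq0 // gt_eqF // (lt_le_trans _ k1).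
have r0 : 1 - k%:~R * d != 0 by rewrite rE irrational_comb_neq0.
have halfE : 2 ^- j.+1 = 2 ^- j / 2 :> R by rewrite exprSr invfM.
have [rd|rd] := leP (1 - k%:~R * d) (d / 2).
  exists (- (k * n)), (1 - k * m); rewrite -rE; split => //.
    by rewrite lt_def r0 subr_ge0.
  by rewrite halfE; lra.
exists ((k + 1) * n), (m - (1 - k * m)).
have -> : ((k + 1) * n)%:~R * rho + (m - (1 - k * m))%:~R = d - (1 - k%:~R * d).
  by rewrite /d !rmorphB !rmorphM rmorphD /=; ring.
split; [|lra|rewrite halfE; lra].
by rewrite mulf_neq0 // gt_eqF //; lia.
Qed.

Lemma exprV2_lt (R : realType) (e : R) : 0 < e -> exists j : nat, 2 ^- j < e.
Proof.
move=> e0; exists (Num.bound e^-1).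
have := archi_boundP (ltW (_ : 0 < e^-1)); rewrite invr_gt0 => /(_ e0).
set j := Num.bound _ => ej.
rewrite -[ltRHS]invrK ltf_pV2 ?posrE ?invr_gt0 ?exprn_gt0 //.
by rewrite (lt_trans ej) // -natrX ltr_nat ltn_expl.
Qed.

(** The multiples of a small positive [d = n rho + m] advance by steps shorter than [e], so one of
    them comes close to any target shifted by an integer. *)
Lemma kronecker_dense (R : realType) (rho x e N : R) :
  irrational rho -> 0 < e ->
  exists n m : int, N <= n%:~R /\ `|n%:~R * rho - m%:~R - x| < e.
Proof.
move=> irr e0; have [j je] := exprV2_lt e0.
have [n [m [n0]]] := irrational_comb_small j irr; set d := _ + _ => d0 dj.
have de : d < e := le_lt_trans dj je.
pose K : int := (Num.bound N)%:Z.
have NK : N <= K%:~R.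
  have [N0|N0] := leP 0 N; last by rewrite (le_trans (ltW N0)) // ler0z.
  exact: (ltW (archi_boundP N0)).
have multiples y : exists M k : int,
    [/\ K <= k, k%:~R * d <= y + M%:~R & y + M%:~R < k%:~R * d + d].
  (* Shifting the target past [K * d] costs nothing modulo 1 and forces the multiplier [k] to be at
     least [K]. *)
  pose M := Num.floor (K%:~R * d - y) + 1.
  exists M, (Num.floor ((y + M%:~R) / d)).
  split.
  - rewrite floor_ge_int ler_pdivlMr //.
    have := floorD1_gt (K%:~R * d - y); rewrite -/M; lra.
  - by rewrite -ler_pdivlMr // floor_le.
  - rewrite -[X in _ < _ + X]mul1r -mulrDl -ltr_pdivrMr //.
    by have := floorD1_gt ((y + M%:~R) / d); rewrite intrD.
(* If [n < 0], large multiples make [k * n] very negative; approximating [- x] and changing signs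
   restores the lower bound. *)
have [np|np] : 0 < n \/ n < 0 by case: (ltgtP n 0) n0 => //; auto.
  have [M [k [Kk k1 k2]]] := multiples x.
  exists (k * n), (M - k * m); split.
    by rewrite (le_trans NK) // ler_int; nia.
  have -> : (k * n)%:~R * rho - (M - k * m)%:~R - x = k%:~R * d - M%:~R - x.
    by rewrite /d rmorphB !rmorphM /=; ring.
  by rewrite ltr_norml; apply/andP; split; lra.
have [M [k [Kk k1 k2]]] := multiples (- x).
exists (- (k * n)), (k * m - M); split.
  by rewrite (le_trans NK) // ler_int; nia.
have -> : (- (k * n))%:~R * rho - (k * m - M)%:~R - x =
    - (k%:~R * d) + M%:~R - x.
  by rewrite /d rmorphB rmorphN !rmorphM /=; ring.
by rewrite ltr_norml; apply/andP; split; lra.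
Qed.

(** * Periodicity and density *)

Lemma freq_ratio (R : realType) (kappa tau : R) : (kappa = 0 -> tau = 0) ->
  freq1 kappa tau / freq2 kappa tau =
  Num.sqrt ((chi2 kappa tau - discr kappa tau) /
            (chi2 kappa tau + discr kappa tau)).
Proof.
move=> kt; have [d0 dc _] := discrP kt.
rewrite /freq1 /freq2 -sqrtrV; last by lra.
by rewrite -sqrtrM; [congr Num.sqrt; field; lra|lra].
Qed.

Lemma model_helix_period (R : realType) (kappa tau T : R) (k l : int) :
  freq1 kappa tau * T = k%:~R * (2 * pi) ->
  freq2 kappa tau * T = l%:~R * (2 * pi) ->
  forall t, model_helix kappa tau 0 (t + T) = model_helix kappa tau 0 t.
Proof.
move=> kT lT t; rewrite /model_helix !model_jet0 !mulrDr kT lT.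
by apply/rowP => i; rewrite !mxE !cosD2piz !sinD2piz.
Qed.

(** A coincidence at a single time suffices: both radii are positive, so each circle determines its
    angle modulo 2 pi. *)
Lemma model_helix_periodP (R : realType) (kappa tau t T : R) :
  (kappa = 0 -> tau = 0) -> kappa != 0 ->
  model_helix kappa tau 0 (t + T) = model_helix kappa tau 0 t ->
  exists k l : int, freq1 kappa tau * T = k%:~R * (2 * pi) /\
    freq2 kappa tau * T = l%:~R * (2 * pi).
Proof.
move=> kt k0; have [_ _ /(_ k0)[r1 r2]] := radiusP kt.
rewrite /model_helix !model_jet0 => /rowP tT.
have angle (r w : R) : 0 < r -> r * cos (w * (t + T)) = r * cos (w * t) ->
    r * sin (w * (t + T)) = r * sin (w * t) ->
    exists k : int, w * T = k%:~R * (2 * pi).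
  move=> r0 rc rs; have rn : r != 0 by rewrite gt_eqF.
  apply: cos_eq1; rewrite (_ : w * T = w * (t + T) - w * t); last by ring.
  by rewrite cosB (mulfI rn rc) (mulfI rn rs) -!expr2 cos2Dsin2.
have := tT 0; have := tT 1; have := tT 2; have := tT 3; rewrite !mxE /=.
move=> s2 c2 s1 c1.
have [k kT] := angle _ _ r1 c1 s1; have [l lT] := angle _ _ r2 c2 s2.
by exists k, l.
Qed.

Lemma rational_div_int (R : realType) (k l : int) :
  rational (k%:~R / l%:~R : R).
Proof. by exists (k%:~R / l%:~R) => //; rewrite fmorph_div /= !ratr_int. Qed.

Lemma periodic_helixP (R : realType) (kappa tau : R) (I : set R)
    (gamma : R -> 'rV[R]_4) :
  0 <= kappa -> 0 <= tau -> (kappa = 0 -> tau = 0) -> helix kappa tau I gamma ->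
  periodic_helix kappa tau I gamma <->
  rational (freq1 kappa tau / freq2 kappa tau).
Proof.
move=> k0 t0 kt hg; have [[_ _ [s Is]] _ _ _ _] := hg.
have [w10 w12 _ _ wp] := freqP kt.
have w2 : 0 < freq2 kappa tau by rewrite (le_lt_trans w10).
have w2n : freq2 kappa tau != 0 by rewrite gt_eqF.
split=> [[T [T0 [J [delta [[IJ hd dg] dT]]]]]|[q _ qE]].
  (* With [kappa = 0] the first radius vanishes and its angle cannot be read off, but then the first
     frequency, and the ratio, is 0. *)
  have [kz|kz] := eqVneq kappa 0.
    have : freq1 kappa tau ^+ 2 * freq2 kappa tau ^+ 2 = 0.
      by rewrite wp kt // expr0n.
    move/eqP; rewrite mulf_eq0 !sqrf_eq0 (negPf w2n) orbF => /eqP ->.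
    by have := rational_div_int R 0 1; rewrite !mul0r.
  (* Taken for the continuation, since [s + T] may lie outside [I]. *)
  have [Q QQ dQ] := helix_normal_form k0 t0 kt hd.
  have [JsT dsT] := dT s Is.
  have [|k [l [kT lT]]] := @model_helix_periodP _ kappa tau s T kt kz.
    rewrite -[LHS](isometry_mxK _ QQ) -[RHS](isometry_mxK _ QQ) -!dQ //.
      by rewrite dsT dg.
    exact: IJ.
  have l0 : l%:~R != 0 :> R.
    apply: contraTneq (mulr_gt0 w2 T0) => l0.
    by rewrite lT l0 mul0r ltxx.
  have -> : freq1 kappa tau / freq2 kappa tau = k%:~R / l%:~R.
    have Tn : T != 0 by rewrite gt_eqF.
    have pn : 2 * pi != 0 :> R by rewrite gt_eqF // mulr_gt0 // pi_gt0.
    rewrite -(mulfK Tn (freq1 _ _)) -(mulfK Tn (freq2 _ _)) kT lT.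
    by move: (2 * pi) pn => p pn; field; rewrite l0 Tn pn.
  exact: rational_div_int.
have dq : 0 < (denq q)%:~R :> R by rewrite ltr0z denq_gt0.
have [Q QQ gQ] := helix_normal_form k0 t0 kt hg.
(* After this time the second angle has made [denq q] full turns and the first one [numq q]. *)
pose T : R := (denq q)%:~R * (2 * pi) / freq2 kappa tau.
have T2 : freq2 kappa tau * T = (denq q)%:~R * (2 * pi).
  by rewrite /T mulrC divfK.
have T1 : freq1 kappa tau * T = (numq q)%:~R * (2 * pi).
  transitivity (freq1 kappa tau / freq2 kappa tau * (freq2 kappa tau * T)).
    by rewrite mulrA divfK.
  by rewrite T2 -qE /ratr mulrA divfK // gt_eqF.
exists T; split; first by rewrite divr_gt0 // !mulr_gt0 // pi_gt0.
exists setT, (fun t => model_helix kappa tau 0 t *m Q); split.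
  by split=> //; [exact: model_is_helix|move=> t It; rewrite gQ].
by move=> t It; rewrite (model_helix_period T1 T2) gQ.
Qed.

Lemma circle_productP (R : realType) (r1 r2 : R) p : 0 < r1 -> 0 < r2 ->
  circle_product r1 r2 p <-> exists x y, p = torus_pt r1 r2 x y.
Proof.
move=> r10 r20; split=> [[/(polar r10)[x [x0 x1]] /(polar r20)[y [y0 y1]]]|].
  exists x, y; apply/rowP => -[[|[|[|[|//]]]] i];
    rewrite mxE /= -?(x0, x1, y0, y1); by congr (p 0 _); apply/val_inj.
move=> [x [y ->]]; rewrite /circle_product /= !mxE /= !exprMn -!mulrDr.
by rewrite !cos2Dsin2 !mulr1.
Qed.

(* The times at which the second angle is [y] form an arithmetic progression,
   along which the first angle is dense modulo [2 * pi]. *)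
Lemma winding_dense (R : realType) (w1 w2 x y e N : R) :
  irrational (w1 / w2) -> 0 < w2 -> 0 < e ->
  exists (t : R) (n m : int),
  [/\ N <= t, w2 * t = y + n%:~R * (2 * pi)
    & `|w1 * t + m%:~R * (2 * pi) - x| < e].
Proof.
move=> irr w20 e0; set rho := w1 / w2 in irr.
have w2n : w2 != 0 by rewrite gt_eqF.
have p0 : 0 < 2 * pi :> R by rewrite mulr_gt0 // pi_gt0.
have pn : 2 * pi != 0 :> R by rewrite gt_eqF.
have [n [m [nN nm]]] := @kronecker_dense _ rho ((x - rho * y) / (2 * pi))
  (e / (2 * pi)) ((N * w2 - y) / (2 * pi)) irr (divr_gt0 e0 p0).
exists ((y + n%:~R * (2 * pi)) / w2), n, (- m); split.
- by move: nN; rewrite ler_pdivrMr // ler_pdivlMr //; lra.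
- by rewrite mulrC divfK.
- move: nm; rewrite ltr_pdivlMr // -[X in _ * X](gtr0_norm p0) -normrM.
  congr (`|_| < e); rewrite /rho rmorphN /=.
  by move: (2 * pi) pn => p pn; field; rewrite w2n pn.
Qed.

(** An interval that misses a point on either side of [a] lies between the two missed points. *)
Lemma unbounded_interval (R : realType) (J : set R) a :
  is_interval J -> J a -> ~ bounded_set J ->
  (forall t, a <= t -> J t) \/ (forall t, t <= a -> J t).
Proof.
move=> iJ Ja nb; apply: contrapT => /not_orP[/existsNP[b] /not_implyP[ab Jb]].
move=> /existsNP[c] /not_implyP[ca Jc]; apply: nb.
rewrite /= /bounded_near; near=> M => t Jt /=.
have bM : `|b| + `|c| <= M by near: M; exact: nbhs_pinfty_ge.
have tb : t <= b.
  rewrite leNgt; apply/negP => bt; apply: Jb; apply: (iJ a t) => //.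
  by rewrite ab ltW.
have ct : c <= t.
  rewrite leNgt; apply/negP => tc; apply: Jc; apply: (iJ t a) => //.
  by rewrite ca ltW.
have := ler_norm b; have := ler_norm (- c); rewrite normrN.
have := normr_ge0 b; have := normr_ge0 c.
by move=> *; rewrite ler_norml; apply/andP; split; lra.
Unshelve. all: by end_near. Qed.

Lemma model_helix_dense (R : realType) (kappa tau : R) (J : set R)
    (Q : 'M[R]_4) :
  (kappa = 0 -> tau = 0) -> kappa != 0 ->
  irrational (freq1 kappa tau / freq2 kappa tau) ->
  open_interval J -> ~ bounded_set J ->
  [set x *m Q | x in circle_product (radius1 kappa tau) (radius2 kappa tau)]
    `<=` closure [set model_helix kappa tau 0 t *m Q | t in J].
Proof.
move=> kt k0 irr [_ iJ [a Ja]] nbJ _ [p + <-].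
have [_ _ /(_ k0)[r1 r2]] := radiusP kt; have [w10 w12 _ _ _] := freqP kt.
have w2 : 0 < freq2 kappa tau by rewrite (le_lt_trans w10).
move=> /(circle_productP _ r1 r2)[x [y ->]] B nB.
(* The second angle will be hit exactly modulo 2 pi, so continuity in the first angle alone is
   enough. *)
pose F (s : R) := torus_pt (radius1 kappa tau) (radius2 kappa tau) s y *m Q.
have cF : {for x, continuous F}.
  apply/differentiable_continuous/derivable1_diffP.
  (* The radius 0 encodes that the last two coordinates do not depend on [s]. *)
  have [//] : is_derive x 1 F
      (torus_pt (radius1 kappa tau) 0 (x + pi / 2) 0 *m Q).
  apply: is_derive_mulmx; apply: is_derive_row => i; rewrite mxE.
  under [X in is_derive _ _ X]eq_fun do rewrite mxE.
  move: i => [[|[|[|[|//]]]] ?] /=; rewrite ?mul0r ?cosDpihalf ?sinDpihalf.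
  - exact: is_deriveZ.
  - exact: is_deriveZ.
  - exact: is_derive_cst.
  - exact: is_derive_cst.
have /nbhs_ballP[e /= e0 eB] := cF _ nB.
suff [t [n [m [Jt tn tm]]]] : exists (t : R) (n m : int),
    [/\ J t, freq2 kappa tau * t = y + n%:~R * (2 * pi)
      & `|freq1 kappa tau * t + m%:~R * (2 * pi) - x| < e].
  exists (model_helix kappa tau 0 t *m Q); split; first by exists t.
  have -> : model_helix kappa tau 0 t *m Q =
      F (freq1 kappa tau * t + m%:~R * (2 * pi)).
    rewrite /F /model_helix model_jet0 tn; congr (_ *m Q).
    by apply/rowP => i; rewrite !mxE !cosD2piz !sinD2piz.
  by apply: eB; rewrite /ball /= distrC.
have [aJ|aJ] := unbounded_interval iJ Ja nbJ.
  have [t [n [m [at_ tn tm]]]] := @winding_dense _ _ _ x y e a irr w2 e0.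
  by exists t, n, m; split=> //; exact: aJ.
(* On a left half-line, time is reversed: large times for the target [(- x, - y)] become very
   negative times for [(x, y)]. *)
have [t [n [m [at_ tn tm]]]] :=
  @winding_dense _ _ _ (- x) (- y) e (- a) irr w2 e0.
exists (- t), (- n), (- m); split.
- by apply: aJ; rewrite lerNl.
- by rewrite mulrN tn rmorphN /=; ring.
- by rewrite -normrN; move: tm; congr (`|_| < e); rewrite rmorphN /=; ring.
Qed.

Lemma derive1n_eq_on (R : realType) (V : normedModType R) (I : set R)
    (f g : R -> V) n :
  open I -> (forall t, I t -> f t = g t) ->
  forall t, I t -> derive1n n f t = derive1n n g t.
Proof.
move=> oI fg; elim: n => [//|n IH] t It; rewrite !derive1nS !derive1E.
apply: near_eq_derive; near=> s; apply: IH; near: s.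
exact: open_nbhs_nbhs.
Unshelve. all: by end_near. Qed.

Theorem theorem2 (R : realType) (kappa tau : R)
    (kappa_ge0 : 0 <= kappa) (tau_ge0 : 0 <= tau)
    (kappa_tau : kappa = 0 -> tau = 0) :
  let chi2 : R := kappa ^+ 2 + tau ^+ 2 + 1 in
  let disc : R := Num.sqrt (chi2 ^+ 2 - 4 * tau ^+ 2) in
  let omega1 : R := Num.sqrt ((chi2 - disc) / 2) in
  let omega2 : R := Num.sqrt ((chi2 + disc) / 2) in
  [/\ (* (1) *)
      forall (I : set R) (alpha beta : R -> 'rV[R]_4),
        helix kappa tau I alpha -> helix kappa tau I beta ->
        exists f, riemannian_isometry (@S3 R) (@S3 R) f /\
          forall t, I t -> beta t = f (alpha t),
      (* (2) *)
      omega1 / omega2 = Num.sqrt ((chi2 - disc) / (chi2 + disc)) /\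
      forall (I : set R) (gamma : R -> 'rV[R]_4),
        helix kappa tau I gamma ->
        (periodic_helix kappa tau I gamma <-> rational (omega1 / omega2))
    & (* (3) and (4), about the same torus T *)
      0 < kappa -> 0 < tau ->
      forall (I : set R) (gamma : R -> 'rV[R]_4),
        helix kappa tau I gamma ->
        exists T : set 'rV[R]_4,
          [/\ clifford_torus_in_S3 T,
              gamma @` I `<=` T
            & irrational (omega1 / omega2) ->
              forall (J : set R) (delta : R -> 'rV[R]_4),
                ~ bounded_set J ->
                helix_continuation kappa tau I gamma J delta ->
                dense_in (delta @` J) T]].
Proof.
move=> c d w1 w2; split.
- move=> I alpha beta ha hb.
  have [P PP aP] := helix_normal_form kappa_ge0 tau_ge0 kappa_tau ha.
  have [Q QQ bQ] := helix_normal_form kappa_ge0 tau_ge0 kappa_tau hb.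
  (* Undo [P] to return from [alpha] to the model, then apply [Q] to reach [beta]. *)
  have OPQ := isometry_mxM (isometry_mx_tr PP) QQ.
  exists (fun x => x *m (P^T *m Q)); split.
    by have := @mulmx_isometry _ (@S3 R) _ OPQ; rewrite image_S3.
  by move=> t It; rewrite aP // bQ // mulmxA isometry_mxK.
- split; first exact: freq_ratio.
  by move=> I gamma; exact: periodic_helixP.
move=> k0 t0 I gamma hg; have kn : kappa != 0 by rewrite gt_eqF.
have [Q QQ gQ] := helix_normal_form kappa_ge0 tau_ge0 kappa_tau hg.
have [r12 _ /(_ kn)[r1 r2]] := radiusP kappa_tau.
set C := circle_product (radius1 kappa tau) (radius2 kappa tau).
have modelC t : C (model_helix kappa tau 0 t).
  apply/circle_productP => //.
  by rewrite /model_helix model_jet0; eexists; eexists.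
exists [set x *m Q | x in C]; split.
- split.
    move=> _ [x /(circle_productP _ r1 r2)[a [b ->]] <-]; apply/S3E.
    by rewrite isometry_mx_dot // dot_torus_pt.
  exists (radius1 kappa tau), (radius2 kappa tau); split => //.
  by exists (fun x => x *m Q); exact: mulmx_isometry.
- by move=> _ [t It <-]; rewrite gQ //; exists (model_helix kappa tau 0 t).
move=> irr J delta nbJ [IJ hd dg].
have [[oI _ [s Is]] _ _ _ _] := hg; have [oJ _ _ _ _] := hd.
(* The torus was built from the matrix [Q] of [gamma]. The continuation has the same matrix: it
   agrees with [gamma] on the open set [I], hence so do all derivatives at [s]. *)
have dQ t : J t -> delta t = model_helix kappa tau 0 t *m Q.
  have hm := helix_sub oJ (@subsetT _ J)
    (model_is_helix kappa_ge0 tau_ge0 kappa_tau QQ).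
  apply: (helix_unique kappa_tau hd hm (IJ _ Is)) => n _.
  by apply: (derive1n_eq_on _ oI) => // x Ix; rewrite dg // gQ.
have -> : delta @` J = [set model_helix kappa tau 0 t *m Q | t in J].
  by apply/seteqP; split=> _ [t Jt <-]; exists t => //; rewrite dQ.
split; last exact: model_helix_dense.
by move=> _ [t _ <-]; exists (model_helix kappa tau 0 t).
Qed.
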